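(* Let $P$ be the set of all Parry numbers and let $Y$ be the set of all Yrrap numbers. Then $P\cap Y^c$ and $P^c\cap Y$ are countably infinite sets.
   Context: Throughout, $\beta>1$ is a non-integer real number, and $\{y\}$ denotes the fractional part of $y\in\mathbb{R}$. $\beta$ is called a Parry number if the orbit of $1$ under the $\beta$-transformation $[0,1]\to[0,1]$, $x\mapsto\{\beta x\}$, is a finite set. $\beta$ is called an Yrrap number if the orbit of $1$ under the negative $\beta$-transformation $[0,1]\to[0,1]$, $x\mapsto 1-\{\beta x\}$, is a finite set. $A^c$ denotes the complement of $A$; thus $P\cap Y^c$ is the set of Parry numbers that are not Yrrap numbers and $P^c\cap Y$ is the set of Yrrap numbers that are not Parry numbers. *)

(* Defs.v *)
From mathcomp Require Import all_boot all_order all_algebra.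
From mathcomp Require Import all_classical all_reals.

Set Implicit Arguments.
Unset Strict Implicit.
Unset Printing Implicit Defensive.

Import Order.TTheory GRing.Theory Num.Theory.

Local Open Scope classical_set_scope.
Local Open Scope ring_scope.

Definition frac_part (R : realType) (y : R) : R := y - (Num.floor y)%:~R.

(* Both transformations map [0, 1] into itself; they are written as maps on all
   of R, which does not affect the orbit of 1. *)
Definition beta_transf (R : realType) (beta x : R) : R := frac_part (beta * x).

Definition neg_beta_transf (R : realType) (beta x : R) : R :=
  1 - frac_part (beta * x).

Definition forward_orbit (T : Type) (f : T -> T) (x : T) : set T :=
  range (fun n : nat => iter n f x).

Definition parry (R : realType) : set R :=
  [set beta | [/\ 1 < beta, beta \isn't a Num.int &
                  finite_set (forward_orbit (beta_transf beta) 1)]].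

Definition yrrap (R : realType) : set R :=
  [set beta | [/\ 1 < beta, beta \isn't a Num.int &
                  finite_set (forward_orbit (neg_beta_transf beta) 1)]].

Definition countably_infinite (T : Type) (A : set T) : Prop :=
  countable A /\ infinite_set A.

Arguments parry R : clear implicits.
Arguments yrrap R : clear implicits.

(* Main.v *)
(* Along the orbit of 1 under either transformation, the iterates are monic
   (up to sign) integer polynomials in beta; hence a finite orbit makes beta
   algebraic, and a coincidence between two iterates is inherited by the "formal
   orbit" obtained by keeping the digits and replacing beta by a conjugate.
   A Parry number beta has no conjugate g in (1, beta), because the difference
   between the orbit and the formal orbit at g would be strictly increasing; an
   Yrrap number has no conjugate g < -1, because the formal orbit at g itself
   would be strictly increasing.  Both obstructions occur infinitely often:
   - x^4 - a x^3 - a x^2 - a with a = 2 mod 4 has a Parry root in (a, a + 1),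
     whose orbit reaches 0 after the digits a, a, 0, a, and a root in (-a, -1);
   - x^4 - (a + 1) x^3 + (a - 1) x^2 - 2 x + (a - 1) with a = 3 mod 4, a > 4, has
     an Yrrap root in (a, a + 1), whose orbit returns to 1 after the digits
     a + 1, a - 1, 2, a, and a root in (1, a).
   Both are Eisenstein at 2, so their roots are conjugate. *)
Require Import Defs.
From mathcomp Require Import all_boot all_order all_algebra.
From mathcomp Require Import all_classical all_reals.
From mathcomp Require Import zify ring lra.

Set Implicit Arguments.
Unset Strict Implicit.
Unset Printing Implicit Defensive.

Import Order.TTheory GRing.Theory Num.Theory.

Local Open Scope classical_set_scope.
Local Open Scope ring_scope.

(** * Collisions in orbits, and criteria for infinite and countable sets *)

Lemma finite_range_collision (T : Type) (f : nat -> T) :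
  finite_set (range f) -> exists m n, (m < n)%N /\ f m = f n.
Proof.
move=> fin; apply: contrapT => ninj.
have inj : {in [set: nat] &, injective f}.
  move=> m n _ _ fmn; apply/eqP; case: (ltngtP m n) => // lt; case: ninj.
    by exists m, n.
  by exists n, m.
by move: fin; rewrite (eq_finite_set (inj_card_eq inj)); exact: infinite_nat.
Qed.

Lemma forward_orbit_finite (T : Type) (f : T -> T) (x : T) (m n : nat) :
  (m < n)%N -> iter m f x = iter n f x -> finite_set (forward_orbit f x).
Proof.
move=> ltmn eqmn.
apply: (@sub_finite_set _ _ ((fun k => iter k f x) @` `I_n)); last first.
  by apply: finite_image; exact: finite_II.
move=> _ [k _ <-]; elim/ltn_ind: k => k IH.
have [ltkn|lenk] := ltnP k n; first by exists k.
have -> : iter k f x = iter (k - n + m) f x.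
  by rewrite iterD eqmn -iterD subnK.
by apply: IH; lia.
Qed.

(** Reduces infinitude to finding one member in each of infinitely many unit intervals: the floors
    tell the members apart. *)
Lemma infinite_of_floor (R : realType) (A : set R) (f : nat -> int) :
  injective f -> (forall k, exists2 x, A x & Num.floor x = f k) ->
  infinite_set A.
Proof.
move=> finj fA finA.
have sub : range f `<=` Num.floor @` A.
  by move=> _ [k _ <-]; have [x Ax <-] := fA k; exists x.
have := sub_finite_set sub (finite_image Num.floor finA).
by move/finite_range_collision => [m [n [ltmn /finj eqmn]]]; lia.
Qed.

Lemma countable_int_poly_roots (R : realType) :
  countable [set x : R | exists2 p : {poly int},
                           p != 0 & root (map_poly intr p) x].
Proof.
apply: (@sub_countable _ _ _
  (\bigcup_(p in [set p : {poly int} | p != 0])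
     [set x : R | root (map_poly intr p) x])).
  by apply: subset_card_le => x [p p0 rx]; exists p.
apply: bigcup_countable => [|p /= p0]; first exact: countableP.
apply: finite_set_countable.
(* An infinite root set would contain [size p] distinct roots, one more than the degree allows. *)
apply: contrapT => /(@infinite_set_fset _ _ (size p))[B BA].
have p0' : map_poly intr p != 0 :> {poly R}.
  rewrite -size_poly_eq0 size_map_inj_poly ?size_poly_eq0 //.
  exact: intr_inj.
have := @max_poly_roots _ (map_poly intr p) (finmap.enum_fset B) p0'.
rewrite finmap.fset_uniq size_map_inj_poly //; last exact: intr_inj.
move=> /(_ _ isT); rewrite ltnNge => H szB.
have /H/negP : all (root (map_poly intr p : {poly R})) (finmap.enum_fset B).
  by apply/allP => x xB; exact: BA.
by [].
Qed.

(** * Affine orbits and the integer polynomials behind their collisions *)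

(* The digits c are kept fixed while the slope x may be a real number or the
   indeterminate 'X. *)
Fixpoint affine_orbit (S : pzRingType) (x : S) (c : nat -> int) (n : nat) : S :=
  if n is n'.+1 then x * affine_orbit x c n' + (c n')%:~R else 1.

Lemma rmorph_affine_orbit (S T : pzRingType) (f : {rmorphism S -> T}) (x : S)
    (c : nat -> int) (n : nat) :
  f (affine_orbit x c n) = affine_orbit (f x) c n.
Proof.
elim: n => [|n IH] /=; first exact: rmorph1.
by rewrite rmorphD rmorphM /= IH rmorph_int.
Qed.

Lemma horner_affine_orbit (R : comNzRingType) (x : R) (c : nat -> int) (n : nat) :
  (map_poly intr (affine_orbit 'X c n : {poly int})).[x] = affine_orbit x c n.
Proof.
rewrite (rmorph_affine_orbit (map_poly intr)) /= map_polyX.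
by rewrite -horner_evalE (rmorph_affine_orbit (horner_eval x)) /=
           horner_evalE hornerX.
Qed.

Lemma size_affine_orbit (c : nat -> int) (n : nat) :
  size (affine_orbit 'X c n : {poly int}) = n.+1.
Proof.
elim: n => [|n IH] /=; first exact: size_poly1.
rewrite mulrC -(rmorph_int polyC).
by rewrite size_MXaddC -size_poly_eq0 IH.
Qed.

Lemma affine_collision_root (R : comNzRingType) (x : R) (c : nat -> int) (m n : nat) :
  affine_orbit x c m = affine_orbit x c n <->
  root (map_poly intr (affine_orbit 'X c n - affine_orbit 'X c m : {poly int})) x.
Proof.
rewrite /root rmorphB hornerD hornerN !horner_affine_orbit subr_eq0 eq_sym.
by split=> /eqP.
Qed.

(** The orbit polynomial of index [k] has degree [k], so the difference of two with distinct indices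
    cannot vanish. *)
Lemma affine_collision_algebraic (R : comNzRingType) (x : R) (c : nat -> int)
    (m n : nat) : (m < n)%N -> affine_orbit x c m = affine_orbit x c n ->
  exists2 p : {poly int}, p != 0 & root (map_poly intr p) x.
Proof.
move=> ltmn /affine_collision_root rx.
exists (affine_orbit 'X c n - affine_orbit 'X c m) => //.
rewrite -size_poly_eq0 size_polyDl ?size_affine_orbit //.
by rewrite size_polyN !size_affine_orbit.
Qed.

(** Over the rationals [p] either divides [q] or is coprime to it; coprimality persists in [R] and
    would forbid the common root [x]. *)
Lemma irreducible_conjugate_root (R : numFieldType) (p q : {poly int}) (x y : R) :
  irreducible_poly p -> root (map_poly intr p) x -> root (map_poly intr p) y ->
  root (map_poly intr q) x -> root (map_poly intr q) y.
Proof.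
move=> /irreducible_rat_int irr.
have ratrK (r : {poly int}) :
    map_poly intr r = map_poly ratr (map_poly (intr : int -> rat) r) :> {poly R}.
  by rewrite -map_poly_comp; apply: eq_map_poly => z /=; rewrite ratr_int.
rewrite !ratrK => px py qx.
case dvd : (map_poly intr p %| map_poly (intr : int -> rat) q).
  by apply: (root_dvdp _ py); rewrite dvdp_map.
move/negbT: dvd; rewrite -irreducible_poly_coprime //.
rewrite -(coprimep_map (ratr : {rmorphism rat -> R})).
by move=> /coprimep_root/(_ px)/negP; case.
Qed.

Lemma affine_collision_conjugate (R : numFieldType) (p : {poly int}) (x y : R)
    (c : nat -> int) (m n : nat) :
  irreducible_poly p -> root (map_poly intr p) x -> root (map_poly intr p) y ->
  affine_orbit x c m = affine_orbit x c n ->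
  affine_orbit y c m = affine_orbit y c n.
Proof.
move=> irr px py /affine_collision_root H.
exact/affine_collision_root/(irreducible_conjugate_root irr px py H).
Qed.

(** * The two transformations as affine orbits; countability *)

Lemma iter_beta_transf (R : realType) (b : R) (n : nat) :
  iter n (beta_transf b) 1 =
  affine_orbit b (fun i => - Num.floor (b * iter i (beta_transf b) 1)) n.
Proof. by elim: n => //= n <-; rewrite intrN. Qed.

Lemma iter_neg_beta_transf (R : realType) (b : R) (n : nat) :
  iter n (neg_beta_transf b) 1 =
  affine_orbit (- b)
    (fun i => 1 + Num.floor (b * iter i (neg_beta_transf b) 1)) n.
Proof.
elim: n => //= n <-; rewrite /neg_beta_transf /frac_part intrD; ring.
Qed.

Lemma beta_transf_bounds (R : realType) (b x : R) : 0 <= beta_transf b x < 1.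
Proof.
rewrite /beta_transf /frac_part; have := floor_itv (b * x).
rewrite intrD; lra.
Qed.

Lemma countable_parry (R : realType) : countable (parry R).
Proof.
apply: sub_countable (countable_int_poly_roots R); apply: subset_card_le.
move=> b [_ _ /finite_range_collision[m [n [ltmn]]]].
rewrite !iter_beta_transf; exact: affine_collision_algebraic.
Qed.

Lemma countable_yrrap (R : realType) : countable (yrrap R).
Proof.
apply: sub_countable (countable_int_poly_roots R); apply: subset_card_le.
move=> b [_ _ /finite_range_collision[m [n [ltmn]]]].
rewrite !iter_neg_beta_transf => /(affine_collision_algebraic ltmn).
(* The slope is [- b], so [p] vanishes there; composing with [- 'X] moves the root to [b]. *)
case=> p p0 rp; exists (p \Po (- 'X)).
  rewrite -size_poly_eq0 size_comp_poly2 ?size_poly_eq0 //.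
  by rewrite size_polyN size_polyX.
rewrite map_comp_poly rmorphN /= map_polyX /root horner_comp.
by rewrite hornerN hornerX.
Qed.

(** * Obstructions coming from conjugates *)

Lemma parry_conjugate (R : realType) (p : {poly int}) (b g : R) :
  irreducible_poly p -> root (map_poly intr p) b -> root (map_poly intr p) g ->
  1 < g -> g < b -> ~ parry R b.
Proof.
move=> irr pb pg g1 gb [_ _ /finite_range_collision[m [n [ltmn]]]] xmn.
have := xmn; rewrite !iter_beta_transf; move=> /(affine_collision_conjugate irr pb pg).
set c := fun i => _; set y := affine_orbit g c; move: xmn.
set x := fun n => iter n (beta_transf b) 1; rewrite -!/(x _) => xmn ymn.
have x0 i : 0 <= x i.
  by case: i => [|i] //=; have /andP[] := beta_transf_bounds b (x i).
have diffS i : x i.+1 - y i.+1 = g * (x i - y i) + (b - g) * x i.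
  rewrite /y /= /c /x /= {1}/beta_transf /frac_part intrN; ring.
have diff0 : x 0%N - y 0%N = 0 by rewrite subrr.
(* In [diffS], the first increase is [b - g > 0], since the orbit starts at 1; afterwards the
   difference is positive and the factor [g > 1] makes it grow, as [x i >= 0]. *)
have xy0 i : 0 <= x i - y i /\ x i - y i < x i.+1 - y i.+1.
  elim: i => [|i [IH1 IH2]].
    by split; rewrite ?diffS diff0 // /x /=; lra.
  have pos : 0 < x i.+1 - y i.+1 by exact: le_lt_trans IH2.
  split; first exact: ltW.
  rewrite [ltRHS]diffS; move: (x0 i.+1) pos.
  move: (x i.+1) (x _ - y _) => u v; nra.
have mono : {homo (fun i => x i - y i) : i j / (i < j)%N >-> i < j}.
  by apply: homo_ltn => [? ? ?|i]; [exact: lt_trans | have [] := xy0 i].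
by have := mono _ _ ltmn; rewrite xmn ymn ltxx.
Qed.

(* Stated for -b and -g, since -b is the slope of the transformation. *)
Lemma yrrap_conjugate (R : realType) (p : {poly int}) (b g : R) :
  irreducible_poly p -> root (map_poly intr p) (- b) ->
  root (map_poly intr p) (- g) -> g < - 1 -> ~ yrrap R b.
Proof.
move=> irr pb pg g1 [b1 _ /finite_range_collision[m [n [ltmn]]]].
rewrite !iter_neg_beta_transf => /(affine_collision_conjugate irr pb pg).
set c := fun i => _.
(* Iterates of 1 are nonnegative, so each floor is at least 0 and each digit at least 1. *)
have c1 i : 1 <= (c i)%:~R :> R.
  rewrite ler1z /c lerDl floor_ge0 mulr_ge0 //; first lra.
  case: i => [|i] //=; rewrite /neg_beta_transf.
  have := beta_transf_bounds b (iter i (neg_beta_transf b) 1).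
  rewrite /beta_transf /neg_beta_transf; lra.
move=> ymn.
have y1 i : 1 <= affine_orbit (- g) c i.
  elim: i => [|i IH] //=; have := c1 i; nra.
have mono : {homo affine_orbit (- g) c : i j / (i < j)%N >-> i < j}.
  apply: homo_ltn => [? ? ?|i]; [exact: lt_trans |].
  rewrite /=; have := c1 i; have := y1 i; nra.
by have := mono _ _ ltmn; rewrite ymn ltxx.
Qed.

(** * Monic quartics: irreducibility and real roots *)

Definition monic_quartic (S : nzRingType) (c0 c1 c2 c3 : S) : {poly S} :=
  Poly [:: c0; c1; c2; c3; 1].

Lemma horner_monic_quartic (S : comNzRingType) (c0 c1 c2 c3 x : S) :
  (monic_quartic c0 c1 c2 c3).[x] =
  x ^+ 4 + c3 * x ^+ 3 + c2 * x ^+ 2 + c1 * x + c0.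
Proof. rewrite /monic_quartic horner_Poly /=; ring. Qed.

Lemma map_monic_quartic (S : nzRingType) (c0 c1 c2 c3 : int) :
  map_poly intr (monic_quartic c0 c1 c2 c3) =
  monic_quartic c0%:~R c1%:~R c2%:~R c3%:~R :> {poly S}.
Proof. by rewrite /monic_quartic map_Poly_id0. Qed.

Lemma irreducible_monic_quartic (p : nat) (c0 c1 c2 c3 : int) : prime p ->
  (p %| c0)%Z -> (p %| c1)%Z -> (p %| c2)%Z -> (p %| c3)%Z ->
  ~~ (p ^+ 2 %| c0)%Z -> irreducible_poly (monic_quartic c0 c1 c2 c3).
Proof.
move=> pr d0 d1 d2 d3 nd0.
have E : monic_quartic c0 c1 c2 c3 = [:: c0; c1; c2; c3; 1] :> seq int.
  exact: (@PolyK _ 0).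
apply: (eisenstein_crit pr); rewrite ?lead_coefE E //=.
- by rewrite dvdz1 absz_nat; apply: contraTneq pr => ->.
- by case=> [|[|[|[|i]]]].
Qed.

Lemma monic_quartic_root (R : realType) (c0 c1 c2 c3 u v : R) : u <= v ->
  (monic_quartic c0 c1 c2 c3).[u] * (monic_quartic c0 c1 c2 c3).[v] < 0 ->
  exists2 x, u < x < v & (monic_quartic c0 c1 c2 c3).[x] = 0.
Proof.
set p := monic_quartic _ _ _ _ => uv puv.
have [x /andP[ux xv] px] : exists2 x, u <= x <= v & root p x.
  (* [poly_ivt] wants a nonpositive value at the left end; otherwise it is applied to [- p]. *)
  have [pu0|pu0] := leP p.[u] 0.
    by apply: poly_ivt => //; nra.
  have [x xuv xp] : exists2 x, u <= x <= v & root (- p) x.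
    by apply: poly_ivt => //; rewrite !hornerN; nra.
  by exists x; rewrite // -rootN.
exists x; last exact/eqP.
rewrite !lt_neqAle ux xv !andbT; apply/andP.
split; apply: contraTneq puv; [move=> ->|move=> <-].
  by rewrite (eqP px) mul0r ltxx.
by rewrite (eqP px) mulr0 ltxx.
Qed.

(** * Explicit finite orbits at roots of the quartics *)

Lemma beta_transfE (R : realType) (b x : R) (k : int) :
  k%:~R <= b * x < (k + 1)%:~R -> beta_transf b x = b * x - k%:~R.
Proof. by move=> /floor_def H; rewrite /beta_transf /frac_part H. Qed.

Lemma neg_beta_transfE (R : realType) (b x : R) (k : int) :
  k%:~R <= b * x < (k + 1)%:~R -> neg_beta_transf b x = 1 - b * x + k%:~R.
Proof.
by move=> /floor_def H; rewrite /neg_beta_transf /frac_part H; ring.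
Qed.

Lemma not_int_between (R : realType) (b : R) (a : int) :
  a%:~R < b < (a + 1)%:~R -> b \isn't a Num.int.
Proof.
move=> ab; apply/negP => /intrP[k bk]; move: ab.
by rewrite bk !ltr_int; lia.
Qed.

(** The orbit is 1, [b - A], [A / b ^+ 2], [A / b], 0, and 0 is fixed. *)
Lemma parry_monic_quartic (R : realType) (a : nat) (b : R) : (1 < a)%N ->
  a%:~R < b < (a%:Z + 1)%:~R ->
  (monic_quartic (- a%:R) 0 (- a%:R) (- a%:R)).[b] = 0 -> parry R b.
Proof.
rewrite horner_monic_quartic -(ltr_nat R) => a1 ab.
have nint := not_int_between ab; move: ab a1; rewrite intrD -pmulrn.
set A : R := a%:R => /andP[Ab bA] A1 pb.
have b0 : 0 < b by lra.
have T1 : beta_transf b 1 = b - A.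
  by rewrite (@beta_transfE _ _ _ a) ?intrD -?pmulrn -/A ?mulr1 //; lra.
(* This is the quartic equation divided by [b ^+ 2]. *)
have E2 : b * (b - A) - A = A / b ^+ 2.
  apply: (mulIf (expf_neq0 2 (lt0r_neq0 b0))).
  by rewrite mulfVK ?expf_neq0 ?lt0r_neq0 //; lra.
have b2 : 0 < A / b ^+ 2 < 1.
  rewrite divr_gt0 ?exprn_gt0 //=; last lra.
  by rewrite ltr_pdivrMr ?exprn_gt0 // mul1r; nra.
have T2 : beta_transf b (b - A) = A / b ^+ 2.
  by rewrite (@beta_transfE _ _ _ a) ?intrD -?pmulrn -/A //; lra.
have E3 : b * (A / b ^+ 2) = A / b by field; exact: lt0r_neq0.
have T3 : beta_transf b (A / b ^+ 2) = A / b.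
  rewrite (@beta_transfE _ _ _ 0) ?add0r ?E3 ?subr0 //.
  by rewrite divr_ge0 ?ltr_pdivrMr //=; lra.
have T4 : beta_transf b (A / b) = 0.
  have E4 : b * (A / b) = A by field; exact: lt0r_neq0.
  by rewrite (@beta_transfE _ _ _ a) E4 ?intrD -?pmulrn -/A; lra.
have T5 : beta_transf b 0 = 0.
  by rewrite (@beta_transfE _ _ _ 0) mulr0 ?subr0 // add0r; lra.
split => //; first lra.
apply: (@forward_orbit_finite _ _ _ 4 5) => //.
by rewrite /= T1 T2 T3 T4 T5.
Qed.

(** The orbit is 1, [1 - b + A], [(2 - (A - 1) / b) / b], [(A - 1) / b], then 1 again; the floors
    are [a], [a - 2], 1, [a - 1], one less than the digits. *)
Lemma yrrap_monic_quartic (R : realType) (a : nat) (b : R) : (4 < a)%N ->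
  a%:~R < b < (a%:Z + 1)%:~R ->
  (monic_quartic (a%:R - 1) (- 2) (a%:R - 1) (- (a%:R + 1))).[b] = 0 ->
  yrrap R b.
Proof.
rewrite horner_monic_quartic -(ltr_nat R) => a4 ab.
have nint := not_int_between ab; move: ab a4; rewrite intrD -pmulrn.
set A : R := a%:R => /andP[Ab bA] A4 pb.
have b0 : 0 < b by lra.
have T1 : neg_beta_transf b 1 = 1 - b + A.
  by rewrite (@neg_beta_transfE _ _ _ a) ?intrD -?pmulrn -/A ?mulr1 //; lra.
have E2 : 1 - b * (1 - b + A) + (A - 2) = (2 - (A - 1) / b) / b.
  have -> : (2 - (A - 1) / b) / b = (2 * b - A + 1) / b ^+ 2.
    by field; exact: lt0r_neq0.
  apply: (mulIf (expf_neq0 2 (lt0r_neq0 b0))).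
  by rewrite mulfVK ?expf_neq0 ?lt0r_neq0 //; lra.
have q : 0 < (A - 1) / b < 1.
  by rewrite divr_gt0 ?ltr_pdivrMr //=; lra.
have q2 : 0 < (2 - (A - 1) / b) / b < 1.
  by rewrite divr_gt0 ?ltr_pdivrMr //=; lra.
have T2 : neg_beta_transf b (1 - b + A) = (2 - (A - 1) / b) / b.
  by rewrite (@neg_beta_transfE _ _ _ (a%:Z - 2)) ?(intrD, intrN) -?pmulrn -/A //;
    lra.
have E3 : b * ((2 - (A - 1) / b) / b) = 2 - (A - 1) / b.
  by field; exact: lt0r_neq0.
have T3 : neg_beta_transf b ((2 - (A - 1) / b) / b) = (A - 1) / b.
  by rewrite (@neg_beta_transfE _ _ _ 1) E3 ?intrD; lra.
have T4 : neg_beta_transf b ((A - 1) / b) = 1.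
  have E4 : b * ((A - 1) / b) = A - 1 by field; exact: lt0r_neq0.
  by rewrite (@neg_beta_transfE _ _ _ (a%:Z - 1)) E4 ?(intrD, intrN) -?pmulrn
    -/A; lra.
split => //; first lra.
apply: (@forward_orbit_finite _ _ _ 0 4) => //.
by rewrite /= T1 T2 T3 T4.
Qed.

(** * The two infinite families *)

Lemma parry_not_yrrap_between (R : realType) (a : nat) : (a %% 4 = 2)%N ->
  exists2 b : R, (parry R `&` ~` yrrap R) b & Num.floor b = a.
Proof.
move=> a2; have a1 : (1 < a)%N by lia.
have A1 : 1 < a%:R :> R by rewrite ltr1n.
have pow2 : a%:R < a%:R ^+ 2 :> R by rewrite ltr_eXnr.
have pow3 : a%:R ^+ 2 < a%:R ^+ 3 :> R by rewrite ltr_eXn2l.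
have pow4 : a%:R ^+ 3 < a%:R ^+ 4 :> R by rewrite ltr_eXn2l.
have [||b /andP[ab ba] pb] :=
  @monic_quartic_root R (- a%:R) 0 (- a%:R) (- a%:R) a%:R (a%:R + 1).
- by lra.
- rewrite !horner_monic_quartic nmulr_rlt0;
    by move: (a%:R : R) A1 pow2 pow3 pow4 => A; nra.
(* The value at [- 1] is [1 - a < 0], and the value at [- a] is positive. *)
have [||g /andP[ag g1] pg] :=
  @monic_quartic_root R (- a%:R) 0 (- a%:R) (- a%:R) (- a%:R) (- 1).
- by lra.
- rewrite !horner_monic_quartic pmulr_rlt0;
    by move: (a%:R : R) A1 pow2 pow3 pow4 => A; nra.
(* The substitution of [- x] for [x] flips the cubic coefficient, as [yrrap_conjugate] takes roots
   [- b] and [- g]. *)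
have irr : irreducible_poly (monic_quartic (- a%:Z) 0 (- a%:Z) a%:Z).
  by apply: (@irreducible_monic_quartic 2) => //; lia.
have root_opp x : (monic_quartic (- a%:R) 0 (- a%:R) (- a%:R)).[x] = 0 ->
    root (map_poly intr (monic_quartic (- a%:Z) 0 (- a%:Z) a%:Z)) (- x : R).
  rewrite map_monic_quartic /root !horner_monic_quartic intrN -pmulrn => <-.
  by apply/eqP; ring.
have abz : a%:~R < b < (a%:Z + 1)%:~R by rewrite intrD -pmulrn ab.
exists b; last by apply: floor_def; rewrite ltW; case/andP: abz.
split; first exact: parry_monic_quartic pb.
exact: yrrap_conjugate irr (root_opp _ pb) (root_opp _ pg) g1.
Qed.

Lemma yrrap_not_parry_between (R : realType) (a : nat) :
  (4 < a)%N -> (a %% 4 = 3)%N ->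
  exists2 b : R, (~` parry R `&` yrrap R) b & Num.floor b = a.
Proof.
move=> a4 a3; have A4 : 4 < a%:R :> R by rewrite (ltr_nat _ 4).
have pow2 : a%:R * 4 < a%:R ^+ 2 :> R by nra.
have pow3 : a%:R ^+ 2 < a%:R ^+ 3 :> R by rewrite ltr_eXn2l //; lra.
have [||b /andP[ab ba] pb] := @monic_quartic_root R
  (a%:R - 1) (- 2) (a%:R - 1) (- (a%:R + 1)) a%:R (a%:R + 1).
- by lra.
- rewrite !horner_monic_quartic nmulr_rlt0;
    by move: (a%:R : R) A4 pow2 pow3 => A; nra.
(* The value at 1 is [a - 4], whence the bound on [a]; the value at [a] is [- (a ^+ 2 + a + 1)]. *)
have [||g /andP[g1 ga] pg] := @monic_quartic_root R
  (a%:R - 1) (- 2) (a%:R - 1) (- (a%:R + 1)) 1 a%:R.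
- by lra.
- rewrite !horner_monic_quartic pmulr_rlt0;
    by move: (a%:R : R) A4 pow2 pow3 => A; nra.
pose p := monic_quartic (a%:Z - 1) (- 2) (a%:Z - 1) (- (a%:Z + 1)).
have irr : irreducible_poly p.
  by apply: (@irreducible_monic_quartic 2) => //; lia.
have pE : map_poly intr p =
    monic_quartic (a%:R - 1) (- 2) (a%:R - 1) (- (a%:R + 1)) :> {poly R}.
  by rewrite map_monic_quartic !(intrN, intrD) -pmulrn.
have abz : a%:~R < b < (a%:Z + 1)%:~R by rewrite intrD -pmulrn ab.
exists b; last by apply: floor_def; rewrite ltW; case/andP: abz.
split; last exact: yrrap_monic_quartic pb.
apply: (@parry_conjugate _ p b g) => //; last exact: lt_trans ab.
  by rewrite /root pE pb.
by rewrite /root pE pg.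
Qed.

Theorem theorem2p7 (R : realType) :
  countably_infinite (parry R `&` ~` yrrap R) /\
  countably_infinite (~` parry R `&` yrrap R).
Proof.
split; split.
- by apply: sub_countable (countable_parry R); apply: subset_card_le => x [].
- apply: (@infinite_of_floor _ _ (fun k => (4 * k + 2)%N%:Z)) => [? ? []|k].
    by lia.
  by apply: parry_not_yrrap_between; lia.
- by apply: sub_countable (countable_yrrap R); apply: subset_card_le => x [].
(* 7 is the least integer above 4 that is 3 modulo 4. *)
- apply: (@infinite_of_floor _ _ (fun k => (4 * k + 7)%N%:Z)) => [? ? []|k].
    by lia.
  by apply: yrrap_not_parry_between; lia.
Qed.
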